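(* Let $B$ be a standard one-dimensional Brownian motion, let $f\colon\mathbb{R}^+\to\mathbb{R}$ be a continuous function, and define the process $X(t)=B(t)-f(t)$, $t\ge0$. (i) Almost surely there are no points in $\mathcal{Z}(X)=\{t>0:X(t)=0\}$ which are local extrema of $X$. (ii) Define $M_X(t)=\max_{0\le s\le t}X(s)$ and the set of record times $\mathrm{Rec}(X)=\{t>0:X(t)=M_X(t)\}$. Almost surely there are no isolated points in the set $\mathrm{Rec}(X)$.
   Context: $\mathbb{R}^+=[0,\infty)$; $B=(B(t))_{t\ge 0}$ starts at $0$. For a real function $g$ on $\mathbb{R}^+$, $\mathcal{Z}(g)$ denotes the set of zeros of $g$ in $(0,\infty)$ (the origin is excluded). *)

(* Defs.v *)
From HB Require Import structures.
From mathcomp Require Import all_boot all_order all_algebra.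
From mathcomp Require Import all_classical all_reals all_analysis.

Set Implicit Arguments.
Unset Strict Implicit.
Unset Printing Implicit Defensive.

Import Order.TTheory GRing.Theory Num.Theory.
Import numFieldNormedType.Exports.

Local Open Scope classical_set_scope.
Local Open Scope ring_scope.

(* Since some of the [A i] may be [setT], the product rule over the whole
   finite family contains the product rule over every subfamily. *)
Definition mutually_independent (R : realType) (d : measure_display)
    (T : measurableType d) (P : probability T R) (I : finType)
    (X : I -> T -> R) : Prop :=
  forall A : I -> set R, (forall i, measurable (A i)) ->
    (P (\bigcap_(i in [set: I]) (X i @^-1` A i)) =
     \prod_(i : I) P (X i @^-1` A i))%E.

(* The time set is [0, +oo[: the values of a process or of a path at negative
   times are never constrained nor used. In [bm_gaussian], the inequality
   [s < t] is strict because [normal_prob] with standard deviation 0 is not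
   the Dirac measure. In [bm_indep], a finite chain of times is given as the
   beginning of a nondecreasing sequence. *)
Record standard_brownian_motion (R : realType) (d : measure_display)
    (T : measurableType d) (P : probability T R) (B : R -> {RV P >-> R}) :
    Prop := StandardBrownianMotion {
  bm_start : {ae P, forall w, B 0 w = 0};
  bm_indep : forall (n : nat) (t : nat -> R), 0 <= t 0%N ->
    {homo t : i j / (i <= j)%N >-> i <= j} ->
    mutually_independent P (fun i : 'I_n => B (t i.+1) \- B (t i));
  bm_gaussian : forall s t : R, 0 <= s -> s < t ->
    forall A : set R, measurable A ->
    pushforward P (B t \- B s) A = normal_prob 0 (Num.sqrt (t - s)) A;
  bm_continuous :
    {ae P, forall w, {within `[0, +oo[, continuous (fun t => B t w)}} }.

Definition zeros (R : realType) (g : R -> R) : set R :=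
  [set t | 0 < t /\ g t = 0].

Definition local_maximum (R : realType) (g : R -> R) (t : R) : Prop :=
  \forall s \near within `[0, +oo[ (nbhs t), g s <= g t.

Definition local_minimum (R : realType) (g : R -> R) (t : R) : Prop :=
  \forall s \near within `[0, +oo[ (nbhs t), g t <= g s.

Definition local_extremum (R : realType) (g : R -> R) (t : R) : Prop :=
  local_maximum g t \/ local_minimum g t.

(* A maximum when [g] is continuous on [0, +oo[. *)
Definition running_max (R : realType) (g : R -> R) (t : R) : R :=
  sup (g @` `[0, t]).

Definition record_times (R : realType) (g : R -> R) : set R :=
  [set t | 0 < t /\ g t = running_max g t].

(* Main.v *)
Require Import Defs.
From HB Require Import structures.
From mathcomp Require Import all_boot all_order all_algebra.
From mathcomp Require Import all_classical all_reals all_analysis.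
From mathcomp Require Import measurable_realfun ring lra zify.

(** For 0 <= p < q < r, the difference of [max X] over [[q, r]] and [max X] over
    [[0, p]] is [B q - B p] plus a quantity depending only on the increments of
    [B] before [p] and after [q]. As [B q - B p] has a bounded density and is
    independent of the rest, this difference is almost surely nonzero. The same
    argument shows that neither [max X] nor [min X] over [[q, r]] vanishes.

    A zero of [X] at a local extremum makes [max X] or [min X] vanish on an
    interval with rational endpoints. If [t] is an isolated record time, then
    for rationals p < q < t < r close to [t] there is no record in [[p, t[], so
    [max X] over [[0, p]] is already [X t]; and there is none in []t, r]], so
    [max X] over [[q, r]] is [X t] as well. Both are null events.

    Independence of the increments is only available as a product rule, so the
    maxima are replaced by maxima over finite grids, and all increments but
    [B q - B p] are rounded to a mesh: the gap then takes the form
    [(B q - B p) + constant] on each of countably many independent events. *)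

Import Order.TTheory GRing.Theory Num.Theory.
Import numFieldNormedType.Exports.

Local Open Scope classical_set_scope.
Local Open Scope ring_scope.

(** * Null sets, countable partitions and Gaussian intervals *)

Lemma ae_forall_countType (d : measure_display) (T : measurableType d)
    (R : realType) (mu : {measure set T -> \bar R}) (I : countType)
    (Q : I -> T -> Prop) :
  (forall i, {ae mu, forall w, Q i w}) -> {ae mu, forall w, forall i, Q i w}.
Proof.
move=> aeQ.
have : {ae mu, forall w, forall n : nat,
    if unpickle n is Some i then Q i w else True}.
  apply: ae_foralln => n; case: (unpickle n) => [i|]; first exact: aeQ.
  exact: aeW.
by apply: filterS => w Qw i; have := Qw (pickle i); rewrite pickleK.
Qed.

(** The cells of [K] are disjoint with total probability 1, so a bound relative to each cell sums up
    to the same bound for [F]. *)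
Lemma countable_partition_le (d : measure_display) (T : measurableType d)
    (R : realType) (P : probability T R) (I : countType) (K : T -> I)
    (F : set T) (c : R) : 0 <= c -> measurable F ->
  (forall i, measurable (K @^-1` [set i])) ->
  (forall i, P (F `&` K @^-1` [set i]) <= c%:E * P (K @^-1` [set i]))%E ->
  (P F <= c%:E)%E.
Proof.
move=> c0 mF mK leFK.
(* [unpickle] may decode a number that is not the code of its result; the test [pickle i == n] lists
   each cell only once. *)
pose A n := if @unpickle I n is Some i then
  (if pickle i == n then K @^-1` [set i] else set0) else set0.
have AP n w : A n w <-> pickle (K w) = n.
  rewrite /A; split.
    by case: unpickle => // i; case: eqP => // <- /= ->.
  by move=> <-; rewrite pickleK eqxx.
have mA n : measurable (A n).
  by rewrite /A; case: unpickle => // i; case: ifP.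
have tA (G : set T) : trivIset setT (fun n => G `&` A n).
  by move=> i j _ _ [w [[_ /AP <-] [_ /AP <-]]].
have UA (G : set T) : \bigcup_n (G `&` A n) = G.
  apply/seteqP; split => [w [n _ []]//|w Gw].
  by exists (pickle (K w)) => //; split => //; apply/AP.
have PA : (\sum_(0 <= n <oo) P (A n) = 1)%E.
  have A_T : (fun n => setT `&` A n) = A by apply/funext => n; rewrite setTI.
  have := UA setT; have := tA setT; rewrite A_T => tA' UA'.
  rewrite -(measure_semi_bigcup P mA tA') UA'//.
  exact: probability_setT.
have mFA n : measurable (F `&` A n) by exact: measurableI.
rewrite -(UA F) measure_semi_bigcup//; last by rewrite UA.
rewrite -[leRHS]mule1 -PA -nneseriesZl//.
apply: lee_nneseries => // n _; rewrite /A; case: unpickle => [i|].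
  by case: ifP => _; [exact: leFK|rewrite setI0 !measure0 mule0].
by rewrite setI0 !measure0 mule0.
Qed.

(** Continuity from below bounds the probability of the limit inferior [L j] by [c / j.+1%:R], and
    the set lies in every [L j]. *)
Lemma negligible_liminf (d : measure_display) (T : measurableType d)
    (R : realType) (P : probability T R) (E : nat -> nat -> set T)
    (c : R) :
  (forall j n, measurable (E j n)) ->
  (forall j n, P (E j n) <= (c / j.+1%:R)%:E)%E ->
  P.-negligible [set w | forall j, \forall n \near \oo, E j n w].
Proof.
move=> mE leE.
pose L j := \bigcup_n \bigcap_(k in [set k | (n <= k)%N]) E j k.
have mI j n : measurable (\bigcap_(k in [set k | (n <= k)%N]) E j k).
  exact: bigcap_measurableType.
have mL j : measurable (L j) by apply: bigcup_measurable.
have PL j : (P (L j) <= (c / j.+1%:R)%:E)%E.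
  have H : (P \o (fun n => \bigcap_(k in [set k | (n <= k)%N]) E j k)) x
      @[x --> \oo] --> P (L j).
    apply: nondecreasing_cvg_mu => [//||n m nm]; first exact: mL.
    apply/subsetPset => w h k /= mk.
    by apply: h; apply: leq_trans mk.
  rewrite -(cvg_lim _ H)//; apply: lime_le; first by apply/cvg_ex; exists (P (L j)).
  apply: nearW => n; apply: le_trans (leE j n).
  by apply: le_measure; rewrite ?inE// => w; apply => /=.
exists (\bigcap_j L j); split.
- exact: bigcap_measurableType.
- apply/eqP; rewrite eq_le measure_ge0 andbT.
  have mLL : measurable (\bigcap_j L j) by exact: bigcap_measurableType.
  have H j : (P (\bigcap_j L j) <= (c / j.+1%:R)%:E)%E.
    apply: le_trans (PL j).
    by apply: le_measure; rewrite ?inE// => w; apply.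
  apply: (@cvge_ge _ \oo _ _ (fun j => (c / j.+1%:R)%:E)); first exact: nearW.
  apply: cvg_EFin; first exact: nearW.
  rewrite -(mulr0 c); apply: cvgM; first exact: cvg_cst.
  exact: cvg_harmonic.
- move=> w /= h j _; have [n _ hn] := h j.
  by exists n => // k /= nk; apply: hn.
Qed.

Lemma normal_prob_itv_le (R : realType) (s x e : R) : s != 0 -> 0 <= e ->
  (normal_prob 0 s `[(x - e)%R, (x + e)%R] <= (normal_peak s * (e *+ 2))%:E)%E.
Proof.
move=> s0 e0.
apply: (@le_trans _ _
  (\int[lebesgue_measure]_(y in `[(x - e)%R, (x + e)%R]) (normal_peak s)%:E)%E).
  apply: ge0_le_integral => //.
  - by move=> y _; rewrite lee_fin normal_pdf_ge0.
  - by apply/measurable_EFinP; apply: measurable_funTS; exact: measurable_normal_pdf.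
  - by move=> y _; rewrite lee_fin normal_pdf_ub.
rewrite integral_cst//= lebesgue_measure_itv /= lte_fin.
case: ifP => _; last by rewrite mule0 lee_fin mulr_ge0 ?normal_peak_ge0 ?mulrn_wge0.
rewrite -EFinD -EFinM lee_fin ler_wpM2l ?normal_peak_ge0//; lra.
Qed.

(** * Records and local maxima of a continuous path *)

Lemma record_timesP (R : realType) (g : R -> R) (t : R) :
  {within `[0, +oo[, continuous g} ->
  record_times g t <-> 0 < t /\ forall s, s \in `[0, t] -> g s <= g t.
Proof.
move=> cg; split => [[t0 gt]|[t0 gt]]; split => //.
  have t0' := ltW t0.
  have [v _ hv] : exists2 v, v \in `[0, t] & forall s, s \in `[0, t] -> g s <= g v.
    apply: EVT_max => //; apply: continuous_subspaceW cg => s /=.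
    by rewrite !in_itv/= andbT => /andP[].
  move=> s st; rewrite gt; apply: ub_le_sup; last by exists s.
  by exists (g v) => _ [y yt <-]; apply: hv.
apply/eqP; rewrite eq_le; apply/andP; split.
  apply: ub_le_sup; first by exists (g t) => _ [y yt <-]; apply: gt.
  by exists t => //=; rewrite in_itv/= lexx ltW.
apply: ge_sup; last by move=> _ [y yt <-]; apply: gt.
by exists (g t), t => //=; rewrite in_itv/= lexx ltW.
Qed.

(** A point near [t], other than [t], that maximizes [g] over its past would be a second record
    ([norec]). Hence [g] does not exceed [g t] on [[t, r]] and has already reached [g t] by time
    [p]; the witness [t'] is [t] itself. *)
Lemma isolated_record_flat (R : realType) (g : R -> R) (t : R) :
  {within `[0, +oo[, continuous g} -> isolated (record_times g) t ->
  exists p q r : rat, [/\ 0 <= p, p < q, q < r &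
    exists t' u : R, [/\ t' \in `[ratr q, ratr r], u \in `[0, ratr p],
      forall s, s \in `[ratr q, ratr r] -> g s <= g t',
      forall s, s \in `[0, ratr p] -> g s <= g u & g t' = g u]].
Proof.
move=> cg [] /set_mem rt [V [h /= h0 hV] VE].
have [t0 gt] := (record_timesP _ _ _ cg).1 rt.
have evt a b : 0 <= a -> a <= b ->
    exists2 v, v \in `[a, b] & forall s, s \in `[a, b] -> g s <= g v.
  move=> a0 ab; apply: EVT_max => //; apply: continuous_subspaceW cg => s /=.
  by rewrite !in_itv/= andbT => /andP[/(le_trans a0)].
have norec v : t - h < v < t + h -> v != t -> 0 < v ->
    ~ (forall s, s \in `[0, v] -> g s <= g v).
  move=> vh /eqP vt v0 gv; apply: vt.
  suff : (V `&` record_times g) v by rewrite VE.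
  split; last by apply/record_timesP.
  by apply: hV; rewrite /ball/= distrC ltr_distlC; lra.
have [p] : exists p, ratr p \in `]Num.max 0 (t - h), t[.
  by apply: rat_in_itvoo; rewrite gt_max t0; lra.
rewrite in_itv/= gt_max => /andP[/andP[p0 ph] pt].
have [q] := rat_in_itvoo pt; rewrite in_itv/= => /andP[pq qt].
have [r] : exists p, ratr p \in `]t, (t + h)[ by apply: rat_in_itvoo; lra.
rewrite in_itv/= => /andP[tr rh].
exists p, q, r; split.
- by rewrite -(ler0q R) ltW.
- by rewrite -(ltr_rat R).
- by rewrite -(ltr_rat R) (lt_trans qt).
have [u ui hu] := evt 0 (ratr p) (lexx _) (ltW p0).
exists t, u; split => //.
- by rewrite in_itv/=; lra.
- move=> s; rewrite in_itv/= => /andP[qs sr].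
  have [st|ts] := leP s t; first by apply: gt; rewrite in_itv/=; lra.
  (* If the maximizer [v] over [[t, s]] had [g v > g t], it would dominate [[0, v]] and be a record
     other than [t]. *)
  have [v] := evt t s (ltW t0) (ltW ts).
  rewrite in_itv/= => /andP[tv vs] hv.
  have [gvt|gtv] := leP (g v) (g t).
    by apply: le_trans gvt; apply: hv; rewrite in_itv/=; lra.
  have vt : v != t by apply: contraTneq gtv => ->; rewrite ltxx.
  exfalso; apply: (norec v) => //; first lra.
    lra.
  move=> y; rewrite in_itv/= => /andP[y0 yv].
  have [yt|ty] := leP y t.
    by apply: (le_trans (gt y _)); rewrite ?in_itv/= ?y0 // ltW.
  by apply: hv; rewrite in_itv/=; lra.
- apply/eqP; rewrite eq_le; apply/andP; split; last first.
    by apply: gt; move: ui; rewrite !in_itv/= => /andP[-> ?]; lra.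
  rewrite leNgt; apply/negP => gut.
  (* If [g u < g t], then [g] exceeds [g u] at some [s] in [[p, t[] close to [t], and the maximizer
     over [[p, s]] is a record before [t]. *)
  have : \forall s \near within `[0, +oo[ (nbhs t), g u < g s.
    have /subspace_continuousP/(_ t) := cg.
    rewrite /= in_itv/= andbT => /(_ (ltW t0)) ct.
    exact: cvgr_gt ct _ gut.
  rewrite near_withinE => -[e /= e0 he].
  pose s := Num.max (ratr p) (t - e / 2).
  have st : s < t by rewrite /s gt_max pt; lra.
  have ps : ratr p <= s by rewrite /s le_max lexx.
  have gus : g u < g s.
    apply: he; last by rewrite /= in_itv/= andbT; lra.
    have : t - e / 2 <= s by rewrite /s le_max lexx orbT.
    by rewrite /ball/= ltr_distl; lra.
  have [v] := evt (ratr p) s (ltW p0) ps.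
  rewrite in_itv/= => /andP[pv vs] hv.
  have guv : g u < g v.
    by apply: (lt_le_trans gus); apply: hv; rewrite in_itv/= ps lexx.
  apply: (norec v); [lra|by rewrite lt_eqF//; lra|lra|].
  move=> y; rewrite in_itv/= => /andP[y0 yv].
  have [yt|ty] := leP y (ratr p).
    by apply: (le_trans (hu y _)); rewrite ?in_itv/= ?y0 // ltW.
  by apply: hv; rewrite in_itv/=; lra.
Qed.

Lemma local_maximum_rat_itv (R : realType) (g : R -> R) (t : R) :
  0 < t -> local_maximum g t ->
  exists q r : rat, [/\ 0 < q, q < r, t \in `[ratr q, ratr r] &
    forall s, s \in `[ratr q, ratr r] -> g s <= g t].
Proof.
move=> t0; rewrite /local_maximum near_withinE => -[h /= h0 hV].
have [q] : exists p, ratr p \in `]Num.max 0 (t - h), t[.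
  by apply: rat_in_itvoo; rewrite gt_max t0; lra.
rewrite in_itv/= gt_max => /andP[/andP[q0 qh] qt].
have [r] : exists p, ratr p \in `]t, (t + h)[ by apply: rat_in_itvoo; lra.
rewrite in_itv/= => /andP[tr rh].
exists q, r; split.
- by rewrite -(ltr0q R).
- by rewrite -(ltr_rat R) (lt_trans qt).
- by rewrite in_itv/=; lra.
move=> s; rewrite in_itv/= => /andP[qs sr]; apply: hV.
  by rewrite /ball/= distrC ltr_distlC; lra.
by rewrite /= in_itv/= andbT; lra.
Qed.

(** * Anticoncentration through one independent coordinate *)

(** Once the other coordinates are rounded to fixed values, [|G| <= e] confines [D m] to an interval
    of half-width [e *+ 2]. Independence makes [small_m] applicable inside each such cell. *)
Lemma independent_anticoncentration (R : realType) (d : measure_display)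
    (T : measurableType d) (P : probability T R) (N : nat)
    (D : 'I_N -> T -> R) (m : 'I_N) (G : ('I_N -> R) -> R) (sg C L e : R) :
  (forall i, measurable_fun setT (D i)) -> mutually_independent P D ->
  `|sg| = 1 -> 0 <= C -> 0 < L -> 0 < e ->
  (forall x e' : R, 0 <= e' ->
    (P (D m @^-1` `[(x - e')%R, (x + e')%R]) <= (C * e')%:E)%E) ->
  (forall x y delta, (forall i, `|x i - y i| <= delta) ->
    `|G x - G y| <= L * delta) ->
  (forall x, G x = sg * x m + G (fun i => if i == m then 0 else x i)) ->
  exists E, [/\ measurable E, forall w, `|G (D^~ w)| <= e -> E w &
    (P E <= (C * (e *+ 2))%:E)%E].
Proof.
move=> mD iD sg1 C0 L0 e0 small_m lipG GE.
have sg2 : sg * sg = 1 by rewrite -expr2 -real_normK ?num_real// sg1 expr1n.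
pose delta := e / L.
have delta0 : 0 < delta by rewrite divr_gt0.
(* Rounding all coordinates but [m] to multiples of [delta] moves [G] by at most
   [e], and [E] is the event that the rounded value of [G] is at most [2 e]. *)
pose K w : {ffun 'I_N -> int} :=
  [ffun i => if i == m then 0 else Num.floor (D i w / delta)].
pose point (k : {ffun 'I_N -> int}) i : R :=
  if i == m then 0 else (k i)%:~R * delta.
pose box (k : {ffun 'I_N -> int}) (J : set R) i : set R := if i == m then J
  else `[(k i)%:~R * delta, (k i + 1)%:~R * delta[%classic.
pose J k := `[- (sg * G (point k)) - e *+ 2, - (sg * G (point k)) + e *+ 2]%classic.
pose E := [set w | J (K w) (D m w)].
have mbox k A : measurable A -> forall i, measurable (box k A i).
  by move=> mA i; rewrite /box; case: ifP.
have mcap k A : measurable A ->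
    measurable (\bigcap_(i in [set: 'I_N]) (D i @^-1` box k A i)).
  move=> mA; apply: fin_bigcap_measurable => // i _.
  by rewrite -[X in measurable X]setTI; apply: mD => //; exact: mbox.
(* [K] is frozen at 0 in coordinate [m], so a cell does not restrict [D m]; its intersection with an
   event on [D m] is a box, to which the product rule applies. *)
have KE (k : {ffun 'I_N -> int}) A : k m = 0 ->
    (D m @^-1` A) `&` (K @^-1` [set k]) =
    \bigcap_(i in [set: 'I_N]) (D i @^-1` box k A i).
  move=> km; apply/seteqP; split => w.
    move=> [/= Aw <-] i _; rewrite /box /= ffunE; case: eqP => [->//|_].
    rewrite /= in_itv/= -ler_pdivlMr// -ltr_pdivrMr//; exact: floor_itv.
  move=> h; split; first by have := h m I; rewrite /box /= eqxx.
  apply/ffunP => i; rewrite /= ffunE; case: (eqVneq i m) => [->//|im].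
  have := h i I; rewrite /box /= (negbTE im) /= in_itv/=.
  by rewrite -ler_pdivlMr// -ltr_pdivrMr//; exact: floor_def.
have KE0 (k : {ffun 'I_N -> int}) : k m != 0 -> K @^-1` [set k] = set0.
  move=> km; apply/seteqP; split => // w /= kw.
  by move: km; rewrite -kw ffunE eqxx eqxx.
have KET (k : {ffun 'I_N -> int}) : k m = 0 -> K @^-1` [set k] =
    \bigcap_(i in [set: 'I_N]) (D i @^-1` box k setT i).
  by move=> km; rewrite -KE// preimage_setT setTI.
have mK k : measurable (K @^-1` [set k]).
  by have [km|km] := eqVneq (k m) 0; [rewrite KET//; exact: mcap|rewrite KE0].
have EK k : E `&` K @^-1` [set k] = D m @^-1` J k `&` K @^-1` [set k].
  by apply/seteqP; split => w [/= + kw]; rewrite /E/= kw.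
have mJ k : measurable (J k) by exact: measurable_itv.
have mEK k : measurable (E `&` K @^-1` [set k]).
  have [km|km] := eqVneq (k m) 0; last by rewrite KE0// setI0.
  by rewrite EK KE//; exact: mcap.
have mE : measurable E.
  have -> : E = \bigcup_k (E `&` K @^-1` [set k]).
    by apply/seteqP; split => [w Ew|w [k _ []]//]; exists (K w).
  exact: countable_bigcupT_measurable.
exists E; split => //.
- move=> w Gw; rewrite /E /J /=.
  (* [y] rounds all coordinates but [m], each by at most [delta = e / L], so [G] moves by at most
     [e]. *)
  pose y i := if i == m then D m w else point (K w) i.
  have : `|G (D^~ w) - G y| <= L * delta.
    apply: lipG => i; rewrite /y /point; case: (eqVneq i m) => [->|im].
      by rewrite subrr normr0 ltW.
    rewrite ffunE (negbTE im); have := floor_itv (D i w / delta).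
    rewrite ler_pdivlMr// ltr_pdivrMr// intrD mulrDl mul1r ler_norml.
    lra.
  rewrite /delta mulrC divfK ?gt_eqF// => GG.
  have : `|G y| <= e *+ 2 by rewrite mulr2n; move: Gw GG; rewrite !ler_norml; lra.
  rewrite GE {1}/y eqxx.
  have -> : (fun i => if i == m then 0 else y i) = point (K w).
    by apply/funext => i; rewrite /y /point; case: eqP.
  have -> : sg * D m w + G (point (K w)) =
      sg * (D m w + sg * G (point (K w))) by rewrite mulrDr mulrA sg2 mul1r.
  by rewrite normrM sg1 mul1r ler_norml in_itv/=; lra.
- apply: (@countable_partition_le _ _ _ _ _ K) => //.
    by rewrite mulr_ge0// mulrn_wge0// ltW.
  move=> k; have [km|km] := eqVneq (k m) 0; last first.
    by rewrite KE0// setI0 !measure0 mule0.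
  rewrite EK KE// KET// !iD; [|exact: mbox|exact: mbox].
  rewrite (bigD1 m)//= [in leRHS](bigD1 m)//= {1 3}/box eqxx.
  rewrite preimage_setT probability_setT mul1e.
  rewrite [X in (_ * X <= _)%E](_ : _ =
      (\prod_(i < N | i != m) P (D i @^-1` box k setT i))%E); last first.
    by apply: eq_bigr => i im; rewrite /box (negbTE im).
  apply: lee_wpmul2r; first by apply: prode_ge0 => i _; exact: measure_ge0.
  by apply: small_m; rewrite mulrn_wge0// ltW.
Qed.

(** * Maxima over finite grids *)

(** Starting from [F 0] instead of a default value makes this commute with adding any constant. *)
Fixpoint prefix_max (R : realType) (F : nat -> R) (n : nat) : R :=
  if n is n'.+1 then Num.max (prefix_max R F n') (F n) else F 0%N.
Arguments prefix_max {R}.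

Lemma eq_prefix_max (R : realType) (F F' : nat -> R) n :
  (forall j, (j <= n)%N -> F j = F' j) -> prefix_max F n = prefix_max F' n.
Proof.
elim: n => [|n IH] h /=; first exact: h.
by rewrite h// IH// => j jn; apply: h; exact: leqW.
Qed.

Lemma prefix_maxD (R : realType) (F : nat -> R) c n :
  prefix_max (fun j => c + F j) n = c + prefix_max F n.
Proof. by elim: n => //= n ->; rewrite addr_maxr. Qed.

Lemma prefix_max_lipschitz (R : realType) (F F' : nat -> R) delta n :
  (forall j, (j <= n)%N -> `|F j - F' j| <= delta) ->
  `|prefix_max F n - prefix_max F' n| <= delta.
Proof.
elim: n => [|n IH] h /=; first exact: h.
have := IH (fun j jn => h j (leqW jn)); have := h n.+1 (leqnn _).
rewrite !ler_norml => /andP[h1 h2] /andP[h3 h4].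
by case: (leP (prefix_max F n)) => ?; case: (leP (prefix_max F' n)) => ?; lra.
Qed.

Lemma le_prefix_max (R : realType) (F : nat -> R) n j :
  (j <= n)%N -> F j <= prefix_max F n.
Proof.
elim: n => [|n IH] /=; first by rewrite leqn0 => /eqP ->.
rewrite leq_eqVlt => /predU1P[->|jn]; first by rewrite le_max lexx orbT.
by rewrite le_max IH.
Qed.

Lemma prefix_max_le (R : realType) (F : nat -> R) n M :
  (forall j, (j <= n)%N -> F j <= M) -> prefix_max F n <= M.
Proof.
elim: n => [|n IH] h /=; first exact: h.
by rewrite ge_max h// IH// => j jn; apply: h; exact: leqW.
Qed.

(** Some grid point lies within one mesh of the maximizer [t], so continuity at [t] gives the lower
    bound; the upper one holds as the grid lies in [[a, b]]. *)
Lemma prefix_max_grid_cvg (R : realType) (g : R -> R) (a b t e : R) :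
  {within `[0, +oo[, continuous g} -> 0 <= a -> a <= b -> t \in `[a, b] ->
  (forall s, s \in `[a, b] -> g s <= g t) -> 0 < e ->
  \forall n \near \oo,
    `|prefix_max (fun j => g (a + (b - a) * (j%:R / n.+1%:R))) n.+1 - g t| <= e.
Proof.
move=> cg a0 ab; rewrite in_itv/= => /andP[at_ tb] gt e0.
have : \forall s \near within `[0, +oo[ (nbhs t), g t - e < g s.
  have /subspace_continuousP/(_ t) := cg.
  rewrite /= in_itv/= andbT => /(_ (le_trans a0 at_)) ct.
  have lt_e : g t - e < g t by rewrite ltrBlDr ltrDl.
  exact: cvgr_gt ct _ lt_e.
rewrite near_withinE => -[h /= h0 hg].
(* Adding 1 keeps the denominator positive when [a = b]. *)
have k0 : 0 < h / (b - a + 1) by rewrite divr_gt0//; lra.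
have := near_infty_natSinv_lt (PosNum k0); apply: filterS => n /= nh.
have n0 : 0 < n.+1%:R :> R by rewrite ltr0n.
have up : prefix_max (fun j => g (a + (b - a) * (j%:R / n.+1%:R))) n.+1 <= g t.
  apply: prefix_max_le => j jn; apply: gt; rewrite in_itv/=.
  have j0 : 0 <= j%:R / n.+1%:R :> R by rewrite divr_ge0.
  have j1 : j%:R / n.+1%:R <= 1 :> R by rewrite ler_pdivrMr// mul1r ler_nat.
  by rewrite lerDl mulr_ge0 ?subr_ge0//= -lerBrDl ler_piMr ?subr_ge0.
have [j jn jt] : exists2 j, (j <= n.+1)%N &
    `|a + (b - a) * (j%:R / n.+1%:R) - t| <= (b - a) * n.+1%:R^-1.
  move: ab; rewrite le_eqVlt => /predU1P[ab|ab].
    exists 0%N => //; have -> : t = a by lra.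
    by rewrite -ab subrr !mul0r addr0 subrr normr0.
  have ba0 : 0 < b - a by lra.
  (* [u] is the position of [t] in units of the mesh; its integer part indexes the last grid point
     up to [t]. *)
  pose u := (t - a) / (b - a) * n.+1%:R.
  have u0 : 0 <= u by rewrite mulr_ge0// divr_ge0//; lra.
  have /andP[ju uj] := truncn_itv u0; exists (Num.truncn u).
    rewrite -(ler_nat R); apply: (le_trans ju).
    rewrite -[leRHS]mul1r ler_wpM2r// ler_pdivrMr// mul1r; lra.
  have tE : t = a + (b - a) * (u / n.+1%:R).
    by rewrite /u mulfK ?gt_eqF// mulrC divfK ?gt_eqF//; lra.
  rewrite {1}tE opprD addrACA subrr add0r -mulrBr normrM gtr0_norm//.
  rewrite ler_pM2l// -mulrBl normrM [X in _ * X]gtr0_norm ?invr_gt0//.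
  rewrite ler_piMl ?invr_ge0// ler_norml.
  by move: uj; rewrite -natr1; lra.
have low : g t - e < g (a + (b - a) * (j%:R / n.+1%:R)).
  have j0 : 0 <= j%:R / n.+1%:R :> R by rewrite divr_ge0.
  apply: hg; last by rewrite /= in_itv/= andbT addr_ge0 ?mulr_ge0 ?subr_ge0.
  rewrite /ball/= distrC; apply: (le_lt_trans jt).
  apply: (@le_lt_trans _ _ ((b - a + 1) * n.+1%:R^-1)).
    by rewrite ler_wpM2r ?invr_ge0//; lra.
  by rewrite mulrC -ltr_pdivlMr//; lra.
rewrite ler_norml.
have := le_prefix_max _ (fun j => g (a + (b - a) * (j%:R / n.+1%:R))) _ _ jn.
move: low up => /=; lra.
Qed.

(* Times [0, ..., n.+1] subdivide [[0, p]], times [n.+2, ..., n.+2 + n.+1]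
   subdivide [[q, r]]: the step from [p] to [q] has index [n.+1]. *)
Definition grid (R : realType) (p q r : R) (n k : nat) : R :=
  if (k <= n.+1)%N then p * (k%:R / n.+1%:R)
  else q + (r - q) * ((k - n.+2)%:R / n.+1%:R).
Arguments grid {R}.

Lemma grid_nondecreasing (R : realType) (p q r : R) n :
  0 <= p -> p <= q -> q <= r ->
  {homo grid p q r n : i j / (i <= j)%N >-> i <= j}.
Proof.
move=> p0 pq qr i j ij; rewrite /grid.
have n0 : 0 < n.+1%:R :> R by rewrite ltr0n.
case: (leqP j n.+1) => jn.
  by rewrite (leq_trans ij jn) ler_wpM2l// ler_wpM2r ?invr_ge0// ler_nat.
case: (leqP i n.+1) => i_n; last first.
  rewrite lerD2l ler_wpM2l ?subr_ge0// ler_wpM2r ?invr_ge0// ler_nat; lia.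
apply: (@le_trans _ _ p); first by rewrite ler_piMr// ler_pdivrMr// mul1r ler_nat.
by apply: (le_trans pq); rewrite lerDl mulr_ge0 ?subr_ge0// divr_ge0.
Qed.

(** * The grid gap as a function of the increments *)

Definition below_sum (R : realType) (N : nat) (x : 'I_N -> R) (k : nat) : R :=
  \sum_(i < N | (i < k)%N) x i.
Arguments below_sum {R N}.

Lemma below_sum_telescope (R : realType) (N : nat) (b : nat -> R) k :
  (k <= N)%N -> below_sum (fun i : 'I_N => b i.+1 - b i) k = b k - b 0%N.
Proof.
move=> kN; rewrite /below_sum -(big_ord_widen N (fun i => b i.+1 - b i) kN).
by rewrite -(big_mkord xpredT (fun i => b i.+1 - b i)) telescope_sumr.
Qed.

Lemma below_sum_lipschitz (R : realType) (N : nat) (x y : 'I_N -> R) delta k :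
  (forall i, `|x i - y i| <= delta) ->
  `|below_sum x k - below_sum y k| <= N%:R * delta.
Proof.
move=> xy; rewrite /below_sum -sumrB; apply: (le_trans (ler_norm_sum _ _ _)).
apply: (@le_trans _ _ (\sum_(i < N) delta)).
  rewrite big_mkcond/=; apply: ler_sum => i _; case: ifP => // _.
  exact: le_trans (xy i).
by rewrite sumr_const card_ord mulr_natl.
Qed.

Lemma below_sum_split (R : realType) (N : nat) (x : 'I_N -> R) (m : 'I_N) k :
  below_sum x k = (if (m < k)%N then x m else 0) +
                  below_sum (fun i => if i == m then 0 else x i) k.
Proof.
rewrite /below_sum; case: ifP => mk.
  rewrite (bigD1 m)//= [in RHS](bigD1 m)//= eqxx add0r; congr (_ + _).
  by apply: eq_bigr => i /andP[_ /negbTE ->].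
rewrite add0r; apply: eq_bigr => i ik; case: eqP => // im.
by rewrite im mk in ik.
Qed.

(* The grid version of [max_[q, r] (sg * X) - c * max_[0, p] X], as a function of
   the vector [x] of the increments of [B] along the grid. *)
Definition grid_gap (R : realType) (f : R -> R) (p q r sg c : R) (n : nat)
    (x : 'I_(n.+1 + n.+2) -> R) : R :=
  prefix_max (fun j => sg * (below_sum x (n.+2 + j) - f (grid p q r n (n.+2 + j))))
    n.+1
  - c * prefix_max (fun j => below_sum x j - f (grid p q r n j)) n.+1.
Arguments grid_gap {R}.

(** A path value moves by at most the number of increments times [delta], maxima do not enlarge
    this, and two maxima enter the gap. *)
Lemma grid_gap_lipschitz (R : realType) (f : R -> R) (p q r sg c : R) (n : nat)
    (x y : 'I_(n.+1 + n.+2) -> R) delta : `|sg| = 1 -> `|c| <= 1 ->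
  (forall i, `|x i - y i| <= delta) ->
  `|grid_gap f p q r sg c n x - grid_gap f p q r sg c n y| <=
    (n.+1 + n.+2)%:R *+ 2 * delta.
Proof.
move=> sg1 c1 xy; rewrite /grid_gap.
set a := prefix_max _ _; set b := prefix_max _ _.
set a' := prefix_max _ _; set b' := prefix_max _ _.
have ha : `|a - a'| <= (n.+1 + n.+2)%:R * delta.
  apply: prefix_max_lipschitz => j _; rewrite -mulrBr normrM sg1 mul1r.
  by rewrite opprB addrA subrK; exact: below_sum_lipschitz.
have hb : `|b - b'| <= (n.+1 + n.+2)%:R * delta.
  apply: prefix_max_lipschitz => j _.
  by rewrite opprB addrA subrK; exact: below_sum_lipschitz.
have -> : a - c * b - (a' - c * b') = (a - a') - c * (b - b') by ring.
apply: (le_trans (ler_normB _ _)).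
rewrite mulr2n mulrDl lerD// normrM; apply: le_trans hb.
by rewrite ler_piMl.
Qed.

(** The increment from [p] to [q] enters every path value on [[q, r]] and none on [[0, p]], so it
    comes out of the first maximum as an additive term. *)
Lemma grid_gap_split (R : realType) (f : R -> R) (p q r sg c : R) (n : nat)
    (x : 'I_(n.+1 + n.+2) -> R) (m : 'I_(n.+1 + n.+2)) : nat_of_ord m = n.+1 ->
  grid_gap f p q r sg c n x = sg * x m +
    grid_gap f p q r sg c n (fun i => if i == m then 0 else x i).
Proof.
move=> mE; rewrite /grid_gap addrA -prefix_maxD; congr (_ - c * _).
  apply: eq_prefix_max => j jn.
  by rewrite (below_sum_split _ _ x m) mE ltn_addr// -addrA mulrDr.
apply: eq_prefix_max => j jn.
by rewrite (below_sum_split _ _ x m) mE ltnNge jn /= add0r.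
Qed.

Lemma grid_gap_increments (R : realType) (f b : R -> R) (p q r sg c : R)
    (n : nat) : b 0 = 0 ->
  grid_gap f p q r sg c n
    (fun i => b (grid p q r n i.+1) - b (grid p q r n i)) =
  prefix_max (fun j => sg * (b (q + (r - q) * (j%:R / n.+1%:R)) -
                             f (q + (r - q) * (j%:R / n.+1%:R)))) n.+1 -
  c * prefix_max (fun j => b (0 + (p - 0) * (j%:R / n.+1%:R)) -
                           f (0 + (p - 0) * (j%:R / n.+1%:R))) n.+1.
Proof.
move=> b0; rewrite /grid_gap.
have S k : (k <= n.+1 + n.+2)%N ->
    below_sum (fun i : 'I_(n.+1 + n.+2) => b (grid p q r n i.+1) -
      b (grid p q r n i)) k = b (grid p q r n k).
  move=> kn; rewrite (below_sum_telescope _ _ (b \o grid p q r n))//=.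
  by rewrite {2}/grid /= mul0r mulr0 b0 subr0.
congr (_ - c * _); apply: eq_prefix_max => j jn; rewrite S; try lia.
  by rewrite /grid ltnNge leq_addr /= addKn.
by rewrite /grid jn add0r subr0.
Qed.

(** * Almost sure gaps for Brownian motion with drift *)

Lemma brownian_increment_itv_le (R : realType) (d : measure_display)
    (T : measurableType d) (P : probability T R) (B : R -> {RV P >-> R})
    (p q x e : R) : standard_brownian_motion B -> 0 <= p -> p < q -> 0 <= e ->
  (P ((B q \- B p)%R @^-1` `[(x - e)%R, (x + e)%R]) <=
    (normal_peak (Num.sqrt (q - p)) *+ 2 * e)%:E)%E.
Proof.
move=> hB p0 pq e0.
have := bm_gaussian hB p0 pq (measurable_itv `[(x - e)%R, (x + e)%R]).
rewrite /pushforward => ->; rewrite mulrnAl -mulrnAr.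
by apply: normal_prob_itv_le => //; rewrite sqrtr_eq0 -ltNge subr_gt0.
Qed.

(* [sg = 1] concerns maxima over [[q, r]] and [sg = -1] minima; with [c = 0] the
   extremum is compared with [0], with [c = 1] to the maximum over [[0, p]]. *)
Lemma drifted_extrema_gap (R : realType) (d : measure_display)
    (T : measurableType d) (P : probability T R) (B : R -> {RV P >-> R})
    (f : R -> R) (p q r sg c : R) : standard_brownian_motion B ->
  {within `[0, +oo[, continuous f} -> 0 <= p -> p < q -> q < r ->
  `|sg| = 1 -> `|c| <= 1 ->
  let X := fun (w : T) (t : R) => B t w - f t in
  {ae P, forall w, ~ exists t u : R, [/\ t \in `[q, r], u \in `[0, p],
    forall s, s \in `[q, r] -> sg * X w s <= sg * X w t,
    forall s, s \in `[0, p] -> X w s <= X w u & sg * X w t = c * X w u]}.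
Proof.
move=> hB cf p0 pq qr sg1 c1 X.
have q0 : 0 <= q by rewrite (le_trans p0)// ltW.
pose D n (i : 'I_(n.+1 + n.+2)) (w : T) :=
  B (grid p q r n i.+1) w - B (grid p q r n i) w.
pose C := normal_peak (Num.sqrt (q - p)) *+ 2.
have C0 : 0 <= C by rewrite mulrn_wge0// normal_peak_ge0.
(* The bound is uniform in [n]: the Lipschitz constant grows with [n] but only affects the rounding
   mesh. *)
have H j n : exists E, [/\ measurable E,
    forall w, `|grid_gap f p q r sg c n ((D n)^~ w)| <= j.+1%:R^-1 -> E w &
    (P E <= (C * (j.+1%:R^-1 *+ 2))%:E)%E].
  have mlt : (n.+1 < n.+1 + n.+2)%N by rewrite -addSnnS leq_addr.
  apply: (@independent_anticoncentration _ _ _ _ _ (D n) (Ordinal mlt)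
    (grid_gap f p q r sg c n) sg C ((n.+1 + n.+2)%:R *+ 2)) => //.
  - by move=> i; apply: measurable_funB.
  - apply: (bm_indep hB); first by rewrite /grid /= mul0r mulr0.
    by apply: grid_nondecreasing => //; exact: ltW.
  - move=> x e e0; have := brownian_increment_itv_le _ _ _ _ _ _ _ x _ hB p0 pq e0.
    suff -> : B q \- B p = D n (Ordinal mlt) by [].
    apply/funext => w; rewrite /D /grid /= ltnn leqnn subnn mul0r mulr0 addr0.
    by rewrite divff ?mulr1// pnatr_eq0.
  - by move=> x y delta; exact: grid_gap_lipschitz.
  - by move=> x; exact: grid_gap_split.
have [E EP] : {E : nat -> nat -> set T | forall j n, [/\ measurable (E j n),
    forall w, `|grid_gap f p q r sg c n ((D n)^~ w)| <= j.+1%:R^-1 -> E j n w &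
    (P (E j n) <= (C * (j.+1%:R^-1 *+ 2))%:E)%E]}.
  by exists (fun j n => projT1 (cid (H j n))) => j n; case: cid.
have negE : {ae P, forall w, ~ forall j, \forall n \near \oo, E j n w}.
  apply: (@negligibleS _ _ _ _ [set w | forall j, \forall n \near \oo, E j n w]).
    by move=> w /= /contrapT.
  apply: (@negligible_liminf _ _ _ _ _ (C *+ 2)) => j n; have [//] := EP j n.
  by move=> _ _; rewrite mulrnAr -mulrnAl.
move: negE (bm_start hB) (bm_continuous hB); apply: filterS3 => w nE B0 cB.
(* If the two sides agree, the grid gap tends to 0, so for each [j] it is eventually at most
   [j.+1%:R^-1], which puts [w] in the null set. *)
move=> [t [u [tqr u0p Xt Xu tu]]]; apply: nE => j.
have cX : {within `[0, +oo[, continuous (X w)}.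
  by move=> s; apply: cvgB; [exact: cB|exact: cf].
have csX : {within `[0, +oo[, continuous (fun s => sg * X w s)}.
  by move=> s; apply: cvgM; [exact: cvg_cst|exact: cX].
have e0 : 0 < j.+1%:R^-1 / 2 :> R by rewrite divr_gt0// invr_gt0.
have := prefix_max_grid_cvg _ _ _ _ _ _ csX q0 (ltW qr) tqr Xt e0.
have := prefix_max_grid_cvg _ _ _ _ _ _ cX (lexx 0) p0 u0p Xu e0.
apply: filterS2 => n hu ht; have [_ + _] := EP j n; apply.
rewrite /D (grid_gap_increments _ f (B^~ w))//.
set a := prefix_max _ _ in ht *; set b := prefix_max _ _ in hu *.
have -> : a - c * b = (a - sg * X w t) - c * (b - X w u) by rewrite tu; ring.
apply: (le_trans (ler_normB _ _)); rewrite [leRHS]splitr lerD// normrM.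
by apply: le_trans hu; rewrite ler_piMl.
Qed.

Theorem proposition3p4 (R : realType) (d : measure_display)
    (T : measurableType d) (P : probability T R) (B : R -> {RV P >-> R})
    (f : R -> R) (hB : standard_brownian_motion B)
    (hf : {within `[0, +oo[, continuous f}) :
  let X := fun (w : T) (t : R) => B t w - f t in
  {ae P, forall w, ~ exists2 t, zeros (X w) t & local_extremum (X w) t} /\
  {ae P, forall w, ~ exists t, isolated (record_times (X w)) t}.
Proof.
move=> X.
(* Rational triples are countable, so one null set serves them all; triples out of order satisfy the
   claim vacuously. *)
have gap sg c : `|sg| = 1 -> `|c| <= 1 ->
    {ae P, forall w, forall i : rat * rat * rat,
      0 <= i.1.1 -> i.1.1 < i.1.2 -> i.1.2 < i.2 ->
      ~ exists t u : R, [/\ t \in `[ratr i.1.2, ratr i.2], u \in `[0, ratr i.1.1],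
      forall s, s \in `[ratr i.1.2, ratr i.2] -> sg * X w s <= sg * X w t,
      forall s, s \in `[0, ratr i.1.1] -> X w s <= X w u &
      sg * X w t = c * X w u]}.
  move=> sg1 c1; apply: ae_forall_countType => -[[p q] r] /=.
  case: (boolP [&& 0 <= p, p < q & q < r]) => [/and3P[p0 pq qr]|h]; last first.
    by apply: aeW => w p0 pq qr; rewrite p0 pq qr in h.
  have := @drifted_extrema_gap R d T P B f (ratr p) (ratr q) (ratr r) sg c hB hf.
  rewrite ler0q !ltr_rat => /(_ p0 pq qr sg1 c1).
  by apply: filterS => w hw _ _ _.
have noext sg : `|sg| = 1 -> {ae P, forall w, ~ exists2 t, zeros (X w) t &
    local_maximum (fun s => sg * X w s) t}.
  move=> sg1; have : `|0 : R| <= 1 by rewrite normr0.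
  move=> /(gap sg _ sg1); apply: filterS => w hw [t [t0 Xt0] mt].
  have [q [r [q0 qr tqr max_t]]] := local_maximum_rat_itv _ _ _ t0 mt.
  (* With [p = 0] the interval [[0, p]] is one point, and [c = 0] turns the comparison into one with
     the value 0. *)
  apply: (hw (0, q, r)) => //; exists t, 0; split => //=.
  - by rewrite in_itv/= lexx ler0q.
  - by move=> s; rewrite in_itv/= raddf0 -eq_le => /eqP ->.
  - by rewrite Xt0 mulr0 mul0r.
have norm1 : `|1 : R| = 1 by rewrite normr1.
have normN1 : `|-1 : R| = 1 by rewrite normrN1.
split.
  (* A local minimum of [X] is a local maximum of [-X]. *)
  move: (noext 1 norm1) (noext (-1) normN1).
  apply: filterS2 => w nmax nmin [t zt [mt|mt]].
    by apply: nmax; exists t => //; apply: filterS mt => s; rewrite !mul1r.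
  by apply: nmin; exists t => //; apply: filterS mt => s; rewrite !mulN1r lerN2.
have : `|1 : R| <= 1 by rewrite normr1.
move=> /(gap 1 _ norm1) h; move: h (bm_continuous hB).
apply: filterS2 => w hw cB [t it].
have cX : {within `[0, +oo[, continuous (X w)}.
  by move=> s; apply: cvgB; [exact: cB|exact: hf].
have [p [q [r [p0 pq qr [t' [u [t'qr u0p max_t max_u tu]]]]]]] :=
  isolated_record_flat _ _ _ cX it.
apply: (hw (p, q, r)) => //; exists t', u; split => //=.
  by move=> s sqr; rewrite !mul1r; exact: max_t.
by rewrite !mul1r.
Qed.
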